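(* Let $\mathcal{G}$ be a sparsity pattern on $n$ $\alpha$-nodes and $m$ $\beta$-nodes. If $\mathcal{G}$ is structurally averaged controllable, then $\mathcal{G}$ is accessible to the $\beta$-nodes.
   Context: Let $n,m$ be positive integers and $\Sigma=[0,1]$. Sparsity patterns. A sparsity pattern is a directed graph $\mathcal{G}=(V,\mathcal{E})$ (self-loops allowed) with node set $V=\{\alpha_1,\ldots,\alpha_n,\beta_1,\ldots,\beta_m\}$ such that no $\beta$-node has an incoming edge. $\mathbb{V}(\mathcal{G})$ denotes the vector space of all pairs $(A,B)\in \mathrm{C}^0(\Sigma,\mathbb{R}^{n\times n}\times\mathbb{R}^{n\times m})$ compliant with $\mathcal{G}$, meaning: the $(j,i)$ entry of $A$ is the zero function whenever $(\alpha_i,\alpha_j)\notin\mathcal{E}$, and the $(j,i)$ entry of $B$ is the zero function whenever $(\beta_i,\alpha_j)\notin\mathcal{E}$. Averaged controllability. Given continuous $A:\Sigma\to\mathbb{R}^{n\times n}$ and $B:\Sigma\to\mathbb{R}^{n\times m}$, consider the linear ensemble system $$\frac{\partial}{\partial t}x(t,\sigma)=A(\sigma)x(t,\sigma)+B(\sigma)u(t),\qquad \sigma\in\Sigma,\ t\ge 0, \tag{E}$$ with $x(t,\sigma)\in\mathbb{R}^n$ and a control input $u(t)\in\mathbb{R}^m$ that does not depend on $\sigma$. System (E) is averaged controllable if for any $x_0\in\mathbb{R}^n$ and any initial profile $x(0,\cdot)\in \mathrm{C}^0(\Sigma,\mathbb{R}^n)$ with $\int_0^1 x(0,\sigma)\,\mathrm{d}\sigma=x_0$,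 any target $x^*\in\mathbb{R}^n$, and any time $T>0$, there is $u\in \mathrm{L}^1([0,T];\mathbb{R}^m)$ such that $\int_0^1 x(T,\sigma)\,\mathrm{d}\sigma=x^*$. $\mathcal{G}$ is structurally averaged controllable if there is a pair $(A,B)\in\mathbb{V}(\mathcal{G})$ such that (E) is averaged controllable. $\mathcal{G}$ is accessible to the $\beta$-nodes if for each $\alpha$-node $\alpha_i$ there exist a $\beta$-node $\beta_j$ and a directed path in $\mathcal{G}$ from $\beta_j$ to $\alpha_i$. *)

(* Defs.v *)
From mathcomp Require Import all_boot all_order all_algebra.
From mathcomp Require Import all_classical all_reals all_analysis.
Import Order.TTheory GRing.Theory Num.Theory.
Import numFieldNormedType.Exports.

Set Implicit Arguments.
Unset Strict Implicit.
Unset Printing Implicit Defensive.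

Local Open Scope classical_set_scope.
Local Open Scope ring_scope.

(* Node set: [inl i] is the alpha-node i, [inr j] is the beta-node j. *)
Definition node (n m : nat) : finType := ('I_n + 'I_m)%type.

Record sparsity_pattern (n m : nat) := SparsityPattern {
  edge :> rel (node n m);
  beta_no_incoming : forall (v : node n m) (j : 'I_m), ~~ edge v (inr j)
}.

Definition Sigma (R : realType) : set R := `[0, 1].

Definition col_integral (R : realType) (n : nat) (D : set R)
    (f : R -> 'cV[R]_n) : 'cV[R]_n :=
  \col_i (\int[lebesgue_measure]_(s in D) f s i ord0).

(* The vector space V(G). A pair of continuous functions on Sigma is given by
   functions on R of which only the restriction to Sigma matters. *)
Definition compliant (R : realType) (n m : nat) (G : sparsity_pattern n m)
    (A : R -> 'M[R]_n) (B : R -> 'M[R]_(n, m)) : Prop :=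
  [/\ {within @Sigma R, continuous A},
      {within @Sigma R, continuous B},
      (forall i j : 'I_n, ~~ G (inl i) (inl j) ->
         forall s, @Sigma R s -> A s j i = 0) &
      (forall (i : 'I_m) (j : 'I_n), ~~ G (inr i) (inl j) ->
         forall s, @Sigma R s -> B s j i = 0)].

Definition L1_control (R : realType) (m : nat) (T : R) (u : R -> 'cV[R]_m) :
    Prop :=
  forall j : 'I_m, lebesgue_measure.-integrable `[0, T]
    (EFin \o (fun t : R => u t j ord0)).

(* As u is only L^1, solutions of dx/dt = A x + B u are in the sense of
   Caratheodory: for every sigma, the integral form of the equation. *)
Definition ensemble_solution (R : realType) (n m : nat)
    (A : R -> 'M[R]_n) (B : R -> 'M[R]_(n, m)) (T : R)
    (u : R -> 'cV[R]_m) (x : R -> R -> 'cV[R]_n) : Prop :=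
  forall s, @Sigma R s ->
    {within `[0, T], continuous (fun t => x t s)} /\
    (forall t, t \in `[0, T] ->
       x t s = x 0 s +
         col_integral `[0, t] (fun r => A s *m x r s + B s *m u r)).

Definition averaged_controllable (R : realType) (n m : nat)
    (A : R -> 'M[R]_n) (B : R -> 'M[R]_(n, m)) : Prop :=
  forall (x0 : 'cV[R]_n) (xi : R -> 'cV[R]_n),
    {within @Sigma R, continuous xi} ->
    col_integral (@Sigma R) xi = x0 ->
    forall (xT : 'cV[R]_n) (T : R), 0 < T ->
    exists (u : R -> 'cV[R]_m) (x : R -> R -> 'cV[R]_n),
      [/\ L1_control T u,
          ensemble_solution A B T u x,
          (forall s, @Sigma R s -> x 0 s = xi s) &
          col_integral (@Sigma R) (x T) = xT].

Definition structurally_averaged_controllable (R : realType) (n m : nat)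
    (G : sparsity_pattern n m) : Prop :=
  exists (A : R -> 'M[R]_n) (B : R -> 'M[R]_(n, m)),
    compliant G A B /\ averaged_controllable A B.

Definition accessible (n m : nat) (G : sparsity_pattern n m) : Prop :=
  forall i : 'I_n, exists j : 'I_m, connect G (inr j) (inl i).

(* Main.v *)
Require Import Defs.
From mathcomp Require Import all_boot all_order all_algebra.
From mathcomp Require Import all_classical all_reals all_analysis.
From mathcomp Require Import ring.
Import Order.TTheory GRing.Theory Num.Theory.
Import numFieldNormedType.Exports.

(** The [alpha]-nodes that no [beta]-node reaches form a set [S] that no edge
    enters from outside: a predecessor of a node of [S] is neither a
    [beta]-node nor a reachable [alpha]-node. Hence for every compliant pair
    the coordinates in [S] of a trajectory obey a homogeneous linear equation
    among themselves, in which the control does not occur. Started from the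
    zero profile they remain zero for every parameter value, so the average of
    such a coordinate cannot be steered to [1], and averaged controllability
    forces [S] to be empty.

    That zero data give the zero solution ([linear_Volterra_eq0]) is a
    contraction argument rather than Gronwall's inequality. The control
    problem lets the horizon [T] be chosen, and the entries of [A] are bounded
    uniformly over the compact parameter interval ([matrix_entries_bounded]),
    so one [T], small enough for all parameters, makes the integral operator a
    contraction. *)

Set Implicit Arguments.
Unset Strict Implicit.
Unset Printing Implicit Defensive.

Local Open Scope classical_set_scope.
Local Open Scope ring_scope.

Lemma within_continuous_sum (T : topologicalType) (R : realType)
    (I : finType) (P : pred I) (D : set T) (f : I -> T -> R) :
  (forall i, P i -> {within D, continuous (f i)}) ->
  {within D, continuous (fun t => \sum_(i | P i) f i t)}.
Proof.
move=> cf.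
rewrite (_ : (fun t => _) = \sum_(i | P i) f i); last first.
  by apply/funext => t; rewrite fct_sumE.
apply: (big_ind (fun g : T -> R => {within D, continuous g})) => //.
- by apply: continuous_subspaceT => x; exact: cst_continuous.
- by move=> g h cg ch x; apply: continuousD; [exact: cg | exact: ch].
Qed.

Lemma within_continuous_entry (T : topologicalType) (R : realType) (p q : nat)
    (D : set T) (A : T -> 'M[R]_(p, q)) (i : 'I_p) (j : 'I_q) :
  {within D, continuous A} -> {within D, continuous (fun t => A t i j)}.
Proof.
apply: (within_continuous_comp D A (fun M : 'M[R]_(p, q) => M i j)).
by move=> M _; exact: coord_continuous.
Qed.

Lemma within_continuous_norm (T : topologicalType) (R : realType)
    (D : set T) (f : T -> R) :
  {within D, continuous f} -> {within D, continuous (fun t => `|f t|)}.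
Proof.
apply: (within_continuous_comp D f (fun x : R => `|x|)).
by move=> x _; exact: norm_continuous.
Qed.

Lemma matrix_entries_bounded (R : realType) (p q : nat) (a b : R)
    (A : R -> 'M[R]_(p, q)) :
  a <= b -> {within `[a, b], continuous A} ->
  exists2 K : R, 0 <= K &
    forall s, s \in `[a, b] -> forall i j, `|A s i j| <= K.
Proof.
move=> ab cA.
pose N s := \sum_i \sum_j `|A s i j|.
have cN : {within `[a, b], continuous N}.
  do 2![apply: within_continuous_sum => ? _].
  exact/within_continuous_norm/within_continuous_entry.
have [c _ Nc] := EVT_max ab cN.
exists (N c); first by do 2![apply: sumr_ge0 => ? _].
move=> s /Nc Ns i j; apply: le_trans Ns.
rewrite /N (bigD1 i) //= (bigD1 j) //= -addrA lerDl.
by apply: addr_ge0; repeat apply: sumr_ge0 => ? _.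
Qed.

Lemma norm_Rintegral_itv_le (R : realType) (f : R -> R) (a b C : R) :
  a <= b -> {within `[a, b], continuous f} ->
  (forall t, t \in `[a, b] -> `|f t| <= C) ->
  `|\int[lebesgue_measure]_(t in `[a, b]) f t| <= C * (b - a).
Proof.
move=> ab cf fC.
have compab : compact (`[a, b] : set R) by exact: segment_compact.
have intf : lebesgue_measure.-integrable `[a, b] (EFin \o f).
  exact: continuous_compact_integrable.
apply: (le_trans (le_normr_Rintegral _ intf)) => //.
have -> : C * (b - a) = \int[lebesgue_measure]_(t in `[a, b]) C.
  rewrite Rintegral_cst //= lebesgue_measure_itv /= lte_fin.
  have [//|ba] := ltP a b.
  by rewrite (le_anti (introT andP (conj ab ba))) subrr mulr0.
apply: le_Rintegral => //.
- by apply: continuous_compact_integrable => //; exact: within_continuous_norm.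
- apply: continuous_compact_integrable => //.
  by apply: continuous_subspaceT => x; exact: cst_continuous.
Qed.

(** Uniqueness for a homogeneous linear system with constant coefficients,
    on a horizon short enough for the integral operator to contract. The sum
    of the [`|y j t|] over [S] attains its maximum [M], and the integral
    equation bounds [M] by [(T * (#|I| * K)) * M]. The equation is only asked
    on [S], which may be a part of a larger system whose remaining coordinates
    satisfy other equations. *)
Lemma linear_Volterra_eq0 (R : realType) (I : finType) (S : {set I})
    (a : I -> I -> R) (y : I -> R -> R) (K T : R) :
  0 <= T -> T * (#|I|%:R * K) < 1 ->
  (forall j k, `|a j k| <= K) ->
  (forall j, j \in S -> {within `[0, T], continuous (y j)}) ->
  (forall j t, j \in S -> t \in `[0, T] ->
     y j t = \int[lebesgue_measure]_(r in `[0, t])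
               (\sum_(k in S) a j k * y k r)) ->
  forall j t, j \in S -> t \in `[0, T] -> y j t = 0.
Proof.
move=> T0 TK aK cy ey.
pose Y t := \sum_(j in S) `|y j t|.
have cY : {within `[0, T], continuous Y}.
  by apply: within_continuous_sum => j jS; apply/within_continuous_norm/cy.
have [c cT Yc] := EVT_max T0 cY.
have Y0 t : 0 <= Y t by apply: sumr_ge0.
have yM j : j \in S -> `|y j c| <= T * K * Y c.
  move=> jS; rewrite (ey _ _ jS cT).
  have /andP[c0 cleT] : 0 <= c <= T by move: cT; rewrite in_itv.
  have K0 : 0 <= K by exact: le_trans (aK j j).
  apply: (@le_trans _ _ (K * Y c * (c - 0))).
    apply: norm_Rintegral_itv_le => //.
      apply: within_continuous_sum => k kS x.
      apply: continuousM; first exact: cst_continuous.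
      apply: (continuous_subspaceW _ (cy _ kS)).
      by move=> z /=; rewrite !in_itv /= => /andP[-> /le_trans ->].
    move=> t tc.
    have tT : t \in `[0, T].
      by move: tc; rewrite !in_itv /= => /andP[-> /le_trans ->].
    apply: (le_trans (ler_norm_sum _ _ _)).
    apply: (@le_trans _ _ (K * Y t)); last exact: ler_wpM2l (Yc _ tT).
    by rewrite /Y mulr_sumr; apply: ler_sum => k _; rewrite normrM ler_wpM2r.
  rewrite subr0 mulrC mulrA; apply: ler_wpM2r => //.
  exact: ler_wpM2r.
have Yc0 : Y c = 0.
  have YM : Y c <= T * (#|I|%:R * K) * Y c.
    have [S0|[j jS]] := set_0Vmem S.
      by rewrite /Y S0 big_set0 mulr0.
    apply: (@le_trans _ _ (\sum_(j in S) T * K * Y c)).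
      by apply: ler_sum => k; exact: yM.
    have -> : T * (#|I|%:R * K) * Y c = #|I|%:R * (T * K * Y c) by ring.
    rewrite sumr_const -[leLHS]mulr_natl ler_wpM2r //.
      by rewrite !mulr_ge0 // (le_trans _ (aK j j)).
    by rewrite ler_nat max_card.
  apply/eqP; rewrite eq_le Y0 andbT leNgt; apply/negP => Ypos.
  by move: YM; rewrite leNgt gtr_pMl // TK.
move=> j t jS /Yc; rewrite Yc0 => Yt.
apply/normr0_eq0/eqP; rewrite eq_le normr_ge0 andbT.
by apply: le_trans Yt; rewrite /Y (bigD1 j) //= lerDl sumr_ge0.
Qed.

Lemma col_integral_eq0 (R : realType) (n : nat) (D : set R)
    (f : R -> 'cV[R]_n) (i : 'I_n) :
  (forall s, D s -> f s i ord0 = 0) -> col_integral D f i ord0 = 0.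
Proof.
move=> f0; rewrite mxE /Rintegral (eq_integral (cst 0%E)) ?integral0 //.
by move=> s /set_mem sD; rewrite f0.
Qed.

(** A set of coordinates that receives nothing from the input or from the other
    coordinates stays at zero once it starts there; the horizon is the
    one of [linear_Volterra_eq0] for the bound [K] on [A s]. *)
Lemma ensemble_solution_isolated_eq0 (R : realType) (n m : nat)
    (A : R -> 'M[R]_n) (B : R -> 'M[R]_(n, m)) (T K s : R)
    (u : R -> 'cV[R]_m) (x : R -> R -> 'cV[R]_n) (S : {set 'I_n}) :
  ensemble_solution A B T u x -> @Sigma R s ->
  0 <= T -> T * (n%:R * K) < 1 -> (forall j k, `|A s j k| <= K) ->
  (forall j k, j \in S -> k \notin S -> A s j k = 0) ->
  (forall j k, j \in S -> B s j k = 0) ->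
  (forall j, j \in S -> x 0 s j ord0 = 0) ->
  forall j t, j \in S -> t \in `[0, T] -> x t s j ord0 = 0.
Proof.
move=> sol sS T0 TK AK A0 B0 x0; have [cx ex] := sol s sS.
apply: (@linear_Volterra_eq0 _ _ S (A s) (fun j t => x t s j ord0) K T) => //.
- by rewrite card_ord.
- by move=> j _; exact: within_continuous_entry.
- move=> j t jS tT; rewrite (ex t tT) !mxE x0 // add0r.
  apply: eq_Rintegral => r _; rewrite !mxE [X in _ + X]big1 ?addr0; last first.
    by move=> k _; rewrite B0 ?mul0r.
  rewrite [RHS]big_mkcond /=; apply: eq_bigr => k _.
  by case: ifPn => // kS; rewrite A0 ?mul0r.
Qed.

Theorem lemma2p3 (R : realType) (n m : nat) (hn : (0 < n)%N) (hm : (0 < m)%N)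
  (G : sparsity_pattern n m) :
  structurally_averaged_controllable R G -> accessible G.
Proof.
move=> [A [B [[cA _ A0 B0] ctrl]]] i.
pose S := [set j : 'I_n | [forall b : 'I_m, ~~ connect G (inr b) (inl j)]]%SET.
have [|] := boolP (i \in S); last first.
  by rewrite inE negb_forall => /existsP[b] /negbNE ?; exists b.
move=> iS; exfalso.
have AS s j k : @Sigma R s -> j \in S -> k \notin S -> A s j k = 0.
  rewrite !inE negb_forall => sS /forallP jS /existsP[b]; rewrite negbK => bk.
  apply: A0 => //; apply/negP => kj.
  by have /negP[] := jS b; apply: connect_trans bk (connect1 kj).
have BS s j b : @Sigma R s -> j \in S -> B s j b = 0.
  rewrite inE => sS /forallP jS; apply: B0 => //; apply/negP => bj.
  by have /negP[] := jS b; apply: connect1.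
have [K K0 AK] := matrix_entries_bounded ler01 cA.
have nK0 : 0 < n%:R * K + 1 by rewrite ltr_wpDl // mulr_ge0.
pose T := (n%:R * K + 1)^-1.
have T0 : 0 < T by rewrite invr_gt0.
have TK : T * (n%:R * K) < 1 by rewrite mulrC ltr_pdivrMr // mul1r ltrDl.
have c0 : {within @Sigma R, continuous (fun _ : R => 0 : 'cV[R]_n)}.
  by apply: continuous_subspaceT => x; exact: cst_continuous.
have [u [x [_ sol xi xT]]] := ctrl _ _ c0 erefl (const_mx 1) T T0.
suff : (const_mx 1 : 'cV[R]_n) i ord0 = 0.
  by rewrite mxE; apply/eqP; exact: oner_neq0.
rewrite -xT; apply: col_integral_eq0 => s sS.
apply: (ensemble_solution_isolated_eq0 sol sS (ltW T0) TK (AK s sS) _ _ _ iS).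
- by move=> j k; exact: AS.
- by move=> j b; exact: BS.
- by move=> j _; rewrite xi // mxE.
- by rewrite in_itv /= lexx ltW.
Qed.
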